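(* For all integers $n,r,s,k\ge 0$ and every triple $(t,u,\ell)\in A\cup B\cup C\cup D\cup E$, where \begin{align*} A&=\{(1,2,5),(7,5,2),(4,8,8),(5,1,1),(2,4,7),(8,7,4)\},\\ B&=\{(4,1,8),(7,4,2),(1,7,5),(8,2,4),(2,5,7),(5,8,1)\},\\ C&=\{(2,0,7),(5,0,1),(8,0,4),(1,0,5),(4,0,8),(7,0,2)\},\\ D&=\{(2,1,2),(8,4,5),(5,7,8),(4,2,1),(1,5,4),(7,8,7)\},\\ E&=\{(7,1,7),(1,4,4),(4,7,1),(5,2,8),(8,5,5),(2,8,2)\}, \end{align*} we have \[\bar{b}^{9k+\ell}_{9r+t,\,9s+u}(9n+3)\equiv 0\pmod{3}.\]
   Context: Write $f_m=\prod_{i\ge 1}(1-q^{mi})$ for $m\ge 1$, and $f_m^a$ for its $a$-th power. For integers $r,s,k\ge 1$, $\bar{b}^k_{r,s}(n)$ denotes the number of overcolored partition $k$-tuples of $n$: $k$-tuples of partitions of total weight $n$ in which each even part may appear in one of $r$ colors, each odd part may appear in one of $s$ colors, and the first occurrence of each part (of each color) in each component may be overlined. Equivalently, as formal power series in $q$, \[\sum_{n=0}^{\infty}\bar{b}^k_{r,s}(n)q^n=\frac{f_2^{(3s-2r)k}}{f_1^{2sk}f_4^{(s-r)k}}.\] If a lower index is $0$, $\bar{b}^k_{r,s}(n)$ is understood to be defined by this generating function. (The superscript is the number of components of the tuple, not a power.) *)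

(* Defs.v *)
From mathcomp Require Import all_boot all_order all_algebra.

Set Implicit Arguments.
Unset Strict Implicit.
Unset Printing Implicit Defensive.

Import GRing.Theory.
Local Open Scope ring_scope.

(* Formal power series in q with integer coefficients: a n is the coefficient
   of q^n. *)
Definition fps := nat -> int.

Definition fps_one : fps := fun n => (n == 0%N)%:R.

Definition fps_mul (a b : fps) : fps :=
  fun n => \sum_(i < n.+1) a i * b (n - i)%N.

(* The coefficients of q^n, ..., q^0, in this order, of the inverse of a series
   with constant coefficient 1. *)
Fixpoint fps_inv_coefs (a : fps) (n : nat) : seq int :=
  if n is n'.+1 then
    let l := fps_inv_coefs a n' in
    - (\sum_(j < n'.+1) a j.+1 * l`_j) :: l
  else [:: 1].

(* Meaningful only when a 0 = 1, see fps_mulrV. *)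
Definition fps_inv (a : fps) : fps := fun n => head 0 (fps_inv_coefs a n).

Definition fps_exp (a : fps) (m : nat) : fps := iter m (fps_mul a) fps_one.

Definition fps_expz (a : fps) (z : int) : fps :=
  match z with
  | Posz m => fps_exp a m
  | Negz m => fps_exp (fps_inv a) m.+1
  end.

Lemma fps_inv_coefsE (a : fps) n j :
  (j <= n)%N -> (fps_inv_coefs a n)`_j = fps_inv a (n - j)%N.
Proof.
by elim: n j => [|n IHn] [|j] // le_jn; rewrite subSS -IHn.
Qed.

Lemma fps_mulrV (a : fps) : a 0%N = 1 -> fps_mul a (fps_inv a) =1 fps_one.
Proof.
move=> a0 [|n]; rewrite /fps_mul big_ord_recl a0 mul1r.
  by rewrite big_ord0 addr0.
rewrite /= {1}/fps_inv /= addrC; apply/eqP; rewrite subr_eq0; apply/eqP.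
apply: eq_bigr => j _; rewrite /bump /= add1n subSS fps_inv_coefsE //.
by rewrite -ltnS ltn_ord.
Qed.

(* f_m = \prod_(i >= 1) (1 - q^(m i)), for m >= 1: the factors with i > n do
   not contribute to the coefficient of q^n. *)
Definition euler_f (m : nat) : fps :=
  fun n => (\prod_(1 <= i < n.+1) (1 - 'X^(m * i)) : {poly int})`_n.

Definition bbar_gf (k r s : nat) : fps :=
  fps_mul (fps_expz (euler_f 2) ((3 * s%:Z - 2 * r%:Z) * k%:Z))
    (fps_mul (fps_expz (euler_f 1) (- (2 * s%:Z * k%:Z)))
             (fps_expz (euler_f 4) (- ((s%:Z - r%:Z) * k%:Z)))).

Definition ncolors (r s i : nat) : nat := if odd i then s else r.

(* The pairs (size, color) with 1 <= size <= n; Tagged c at index i stands for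
   the part of size i.+1 and color c. *)
Definition colored_part (r s n : nat) : finType :=
  {i : 'I_n & 'I_(ncolors r s i.+1)}.

(* An overcolored partition with parts of size at most n: each colored part is
   sent to its multiplicity and to a flag telling whether its first occurrence
   is overlined. Bounding multiplicities by n is harmless at weight n. *)
Definition marked_partition (r s n : nat) : finType :=
  {ffun colored_part r s n -> 'I_n.+1 * bool}.

Definition overcolored (r s n : nat) (la : marked_partition r s n) : bool :=
  [forall p, (la p).2 ==> (0 < (la p).1)%N].

Definition weight (r s n : nat) (la : marked_partition r s n) : nat :=
  (\sum_(p : colored_part r s n) (tag p).+1 * (la p).1)%N.

Definition overcolored_tuples (k r s n : nat) :
    {set {ffun 'I_k -> marked_partition r s n}} :=
  [set L : {ffun 'I_k -> marked_partition r s n} |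
    [forall j, overcolored (L j)] && ((\sum_j weight (L j))%N == n)].

(* bbar k r s n is \bar{b}^k_{r,s}(n): a count when r, s >= 1, and a coefficient
   of the generating function when a lower index is 0. *)
Definition bbar (k r s n : nat) : int :=
  if (0 < r)%N && (0 < s)%N then #|overcolored_tuples k r s n|%:Z
  else bbar_gf k r s n.

Local Open Scope nat_scope.

Definition triplesA : seq (nat * nat * nat) :=
  [:: (1, 2, 5); (7, 5, 2); (4, 8, 8); (5, 1, 1); (2, 4, 7); (8, 7, 4)].
Definition triplesB : seq (nat * nat * nat) :=
  [:: (4, 1, 8); (7, 4, 2); (1, 7, 5); (8, 2, 4); (2, 5, 7); (5, 8, 1)].
Definition triplesC : seq (nat * nat * nat) :=
  [:: (2, 0, 7); (5, 0, 1); (8, 0, 4); (1, 0, 5); (4, 0, 8); (7, 0, 2)].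
Definition triplesD : seq (nat * nat * nat) :=
  [:: (2, 1, 2); (8, 4, 5); (5, 7, 8); (4, 2, 1); (1, 5, 4); (7, 8, 7)].
Definition triplesE : seq (nat * nat * nat) :=
  [:: (7, 1, 7); (1, 4, 4); (4, 7, 1); (5, 2, 8); (8, 5, 5); (2, 8, 2)].

(* Main.v *)
(* Let phi(q) = sum of q^(j^2) over all integers j, so that phi(-q) = f_1^2/f_2
   and phi(q) = f_2^5/(f_1^2 f_4^2). Modulo 3, f_m^9 is a series in q^9, so only
   the exponents of f_1, f_2, f_4 modulo 9 matter, and for a triple of A, B, C,
   D or E the generating function is congruent to a series in q^9 times
   phi(-q^2)^3 Q(q), with Q(q) = phi(q), phi(-q), phi(-q^2), phi(q)^2 or
   phi(-q)^2 respectively. Cubing being additive modulo 3, phi(-q^2)^3 only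
   involves the powers q^(6 z^2). As squares are 0, 1, 4 or 7 modulo 9, no
   exponent of the product is congruent to 3 modulo 9.
   All series are taken in R = F_3[X]/(X^(n+1)); the identities hold in any ring
   with units at an element y such that y^(n+1) = 0. *)
Require Import Defs.
From mathcomp Require Import all_boot all_order all_algebra.
From mathcomp Require Import qpoly ring zify.

Set Implicit Arguments.
Unset Strict Implicit.
Unset Printing Implicit Defensive.

Import GRing.Theory.
Local Open Scope ring_scope.

(** * Gaussian binomial coefficients and the finite form of Gauss's theta identity *)

Fixpoint qbin (R : comNzRingType) (q : R) (m j : nat) : R :=
  match m, j with
  | _, 0 => 1
  | 0, _.+1 => 0
  | m'.+1, j'.+1 => qbin q m' j + q ^+ (m' - j') * qbin q m' j'
  end.

Arguments qbin : simpl never.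

Section QBinomial.
Variable R : comNzRingType.
Implicit Types q x y e : R.

Definition qfact q m : R := \prod_(i < m) (1 - q ^+ i.+1).

Lemma qfactS q m : qfact q m.+1 = qfact q m * (1 - q ^+ m.+1).
Proof. exact: big_ord_recr. Qed.

Lemma qbin0 q m : qbin q m 0 = 1.
Proof. by case: m. Qed.

Lemma qbinS q m j :
  qbin q m.+1 j.+1 = qbin q m j.+1 + q ^+ (m - j) * qbin q m j.
Proof. by []. Qed.

Lemma qbin_small q m j : (m < j)%N -> qbin q m j = 0.
Proof.
elim: m j => [|m IHm] [|j] // lt_mj; rewrite qbinS !IHm ?mulr0 ?addr0 //.
exact: ltnW.
Qed.

(** The recursion of [qbin] combines with 1 - q^(m+1) = (1 - q^(m-j)) + q^(m-j) (1 - q^(j+1)). The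
    factorial formula is kept free of division, so that it holds in any commutative ring. *)
Lemma qbin_qfact q m j :
  (j <= m)%N -> qbin q m j * qfact q j * qfact q (m - j) = qfact q m.
Proof.
elim: m j => [|m IHm] [|j] // le_jm.
- by rewrite /qfact !big_ord0 !mulr1.
- by rewrite qbin0 subn0 /qfact big_ord0 !mul1r.
rewrite qbinS subSS; move: le_jm; rewrite ltnS leq_eqVlt => /orP[/eqP->|lt_jm].
  have Hm := IHm m (leqnn m); rewrite subnn in Hm.
  by rewrite qbin_small // subnn !qfactS -[in RHS]Hm; ring.
have def_mj : (m - j = (m - j.+1).+1)%N by rewrite -subSn.
have /IHm := lt_jm; have /IHm := ltnW lt_jm.
rewrite def_mj !qfactS -def_mj => Hj Hj1.
have -> : q ^+ m.+1 = q ^+ (m - j) * q ^+ j.+1.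
  by rewrite -exprD; congr (_ ^+ _); lia.
transitivity (qfact q m * (1 - q ^+ (m - j)) +
    q ^+ (m - j) * (1 - q ^+ j.+1) * qfact q m); last by ring.
by rewrite -{1}Hj1 -Hj; ring.
Qed.

(** Cauchy's q-binomial theorem, by induction on m: after multiplication by x + y q^m, the term in
    y^(j+1) collects contributions from j+1 and j, which the recursion of [qbin] merges. *)
Lemma qbinomial q x y m :
  \prod_(i < m) (x + y * q ^+ i) =
  \sum_(j < m.+1) q ^+ 'C(j, 2) * qbin q m j * y ^+ j * x ^+ (m - j).
Proof.
elim: m => [|m IHm].
  by rewrite big_ord0 big_ord_recl big_ord0 !mulr1 addr0.
rewrite big_ord_recr /= {}IHm mulrDr.
rewrite big_distrl [X in _ + X]big_distrl /=.
rewrite [RHS]big_ord_recl [X in X + _ = _]big_ord_recl /= !qbin0.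
rewrite !subn0 expr0 !mul1r -exprSr -addrA; congr (_ + _).
rewrite [RHS](eq_bigr (fun i : 'I_m.+1 =>
    q ^+ 'C(i.+1, 2) * qbin q m i.+1 * y ^+ i.+1 * x ^+ (m - i) +
    q ^+ 'C(i, 2) * qbin q m i * y ^+ i * x ^+ (m - i) * (y * q ^+ m))) => [|i _].
  rewrite big_split /= [X in _ = X + _]big_ord_recr /= qbin_small // mulr0 !mul0r.
  rewrite addr0; congr (_ + _); apply: eq_bigr => i _.
  by rewrite /bump /= add1n -mulrA -exprSr subnSK.
rewrite /bump /= !add1n subSS qbinS binS bin1 mulrDr !mulrDl; congr (_ + _).
(* The factor q^i raises 'C(i, 2) to 'C(i+1, 2), and q^(m-i) is the weight in the recursion of
   [qbin]. *)
have -> : q ^+ m = q ^+ i * q ^+ (m - i).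
  by rewrite -exprD; congr (_ ^+ _); have := ltn_ord i; lia.
by rewrite exprD exprS; ring.
Qed.

End QBinomial.

Lemma rmorph_qbin (R S : comNzRingType) (f : {rmorphism R -> S}) q m j :
  f (qbin q m j) = qbin (f q) m j.
Proof.
elim: m j => [|m IHm] [|j]; rewrite ?rmorph1 ?rmorph0 //.
by rewrite !qbinS rmorphD rmorphM rmorphXn !IHm.
Qed.

(* The q-binomial theorem with base X^2, y = e and x = X^(2n-1); the factor
   e^n X^(3n^2-2n) common to both sides has been cancelled. *)
Lemma finite_gauss (R : comNzRingType) (e y : R) n : e * e = 1 ->
  \prod_(i < n) (1 + e * y ^+ i.*2.+1) ^+ 2 =
  \sum_(j < n.*2.+1)
    e ^+ (n + j) * y ^+ (`|j - n| ^ 2) * qbin (y ^+ 2) n.*2 j.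
Proof.
move=> ee.
pose eX : {poly R} := e%:P.
have eeX : eX * eX = 1 by rewrite -polyCM ee.
(* The identity is proved for the indeterminate and then evaluated at y: a power of 'X can be
   cancelled, while y is going to be nilpotent. *)
suff /(congr1 (fun p => p.[y])) H : \prod_(i < n) (1 + eX * 'X ^+ i.*2.+1) ^+ 2 =
  \sum_(j < n.*2.+1)
    eX ^+ (n + j) * 'X ^+ (`|j - n| ^ 2) * qbin ('X ^+ 2) n.*2 j.
  move: H; rewrite horner_prod horner_sum => H.
  rewrite [LHS](eq_bigr (fun i : 'I_n => ((1 + eX * 'X ^+ i.*2.+1) ^+ 2).[y])).
    rewrite H; apply: eq_bigr => j _.
    have := rmorph_qbin (horner_eval y) 'X^2 n.*2 j.
    rewrite /= /horner_eval hornerXn => <-.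
    by rewrite !hornerM -rmorphXn hornerC !hornerXn.
  by move=> i _; rewrite !(hornerE, hornerXn).
(* The case of no factors is split off so that the exponent 2m - 1, with m = n + 1, becomes
   [n.*2.+1] without truncated subtraction. *)
case: n => [|n]; first by rewrite big_ord0 big_ord_recl big_ord0 !mul1r addr0.
set m := n.+1; pose K := (m * (3 * m - 2))%N.
have lregXK : GRing.lreg (eX ^+ m * 'X^K).
  move=> p p' /(congr1 (fun r => eX ^+ m * r)); rewrite !mulrA -exprMn eeX.
  by rewrite expr1n !mul1r; apply: (monic_lreg (monicXn _ _)).
apply: lregXK; have := qbinomial 'X^2 'X^(n.*2.+1) eX m.*2.
have -> : \prod_(i < m.*2) ('X^(n.*2.+1) + eX * 'X^2 ^+ i) =
    \prod_(i < m + m) ('X^(n.*2.+1) + eX * 'X^2 ^+ i) by rewrite addnn.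
rewrite big_split_ord /= => H.
transitivity (\prod_(i < m) ('X^(n.*2.+1) + eX * 'X^2 ^+ i) *
  \prod_(i < m) ('X^(n.*2.+1) + eX * 'X^2 ^+ (m + i))).
  (* In the first m factors e X^(2i) is pulled out, using e^2 = 1. What remains is 1 + e
     X^(2(m-1-i)+1), hence the reversal of the index. *)
  have -> : \prod_(i < m) ('X^(n.*2.+1) + eX * 'X^2 ^+ i) =
      eX ^+ m * 'X^(m * n) * \prod_(i < m) (1 + eX * 'X^(i.*2.+1)).
    have -> : (m * n = \sum_(i < m) i.*2)%N.
      rewrite /m; elim: (n) => [|k IHk]; first by rewrite big_ord_recl big_ord0.
      by rewrite big_ord_recr /= -IHk; lia.
    rewrite [X in _ = _ * X](reindex_inj rev_ord_inj) expr_sum.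
    rewrite -[in eX ^+ m](card_ord m) -prodr_const -!big_split.
    apply: eq_bigr => i _ /=.
    rewrite mulrDr mulr1 addrC -exprM mul2n; congr (_ + _).
    rewrite mulrACA eeX mul1r -exprD; congr ('X^_).
    by have := ltn_ord i; rewrite /m; lia.
  (* In the last m factors X^(2m-1) is pulled out; the same odd product remains, which produces the
     square. *)
  have -> : \prod_(i < m) ('X^(n.*2.+1) + eX * 'X^2 ^+ (m + i)) =
      'X^(n.*2.+1 * m) * \prod_(i < m) (1 + eX * 'X^(i.*2.+1)).
    rewrite exprM -[in X in X * _](card_ord m) -prodr_const -!big_split.
    apply: eq_bigr => i _ /=.
    rewrite mulrDr mulr1 -exprM mulrCA -exprD.
    by congr (_ + _ * 'X^_); rewrite /m; lia.
  rewrite prodrXl; set P := \prod_(i < m) _.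
  have -> : K = (m * n + n.*2.+1 * m)%N by rewrite /K /m; lia.
  by rewrite exprD; ring.
rewrite {}H big_distrr /=; apply: eq_bigr => j _.
have le_jm : (j <= m.*2)%N by rewrite -ltnS.
(* Completing the square: 3m^2 - 2m + (j-m)^2 = j(j-1) + (2m-1)(2m-j). The differences are replaced
   by f = 2m - j and d = |j - m| to stay within natural numbers. *)
have expE : (K + `|j - m| ^ 2 = 2 * 'C(j, 2) + n.*2.+1 * (m.*2 - j))%N.
  have := mul_bin_diag j 1; rewrite bin1 => <-.
  have [f def_f] : exists f, (j + f = m.*2)%N by exists (m.*2 - j)%N; rewrite subnKC.
  have -> : (m.*2 - j = f)%N by lia.
  have [d def_d dE] : exists2 d, (d + m = j \/ d + j = m)%N & `|j - m|%N = d.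
    by exists `|j - m|%N; lia.
  rewrite dE -mulnn; move: (nat_of_ord j) def_f def_d => i def_f def_d {le_jm dE j}.
  have KE : (K + 2 * m = 3 * (m * m))%N by rewrite /K /m; nia.
  have iE : (i * i.-1 + i = i * i)%N by case: (i) => [|k] //=; nia.
  have fE : (n.*2.+1 * f + f = 2 * (m * f))%N by rewrite /m; nia.
  clearbody m K; case: def_d => [Ei|Em].
    have Em : (m = d + f)%N by lia.
    by subst i; subst m; nia.
  have Ef : (f = i + d + d)%N by lia.
  by subst f; subst m; nia.
have powE : 'X^2 ^+ 'C(j, 2) * 'X^(n.*2.+1) ^+ (m.*2 - j) =
    'X^K * 'X^(`|j - m| ^ 2) :> {poly R}.
  by rewrite -!exprM -!exprD expE.
have eem : eX ^+ m * eX ^+ m = 1 by rewrite -exprMn eeX expr1n.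
rewrite [eX ^+ (m + j)]exprD mulrAC -[_ * _ * _ ^+ (m.*2 - j)]mulrA.
move: powE eem; set q := qbin _ _ _.
move: ('X^2 ^+ _) ('X^(n.*2.+1) ^+ _) 'X^K 'X^(`|j - m| ^ 2) (eX ^+ m) (eX ^+ j).
move=> a b c d em ej powE eem.
transitivity (a * b * (q * ej)); first by ring.
by rewrite powE -[LHS]mul1r -eem; ring.
Qed.

(** * Euler products at a nilpotent element *)

Lemma qfact_absorb (R : comNzRingType) (a q : R) m n :
  (m <= n)%N -> a * q ^+ m.+1 = 0 -> a * qfact q n = a * qfact q m.
Proof.
move=> le_mn aq0; rewrite -(subnKC le_mn); elim: (n - m)%N => [|k IHk].
  by rewrite addn0.
(* The new factor is 1 - q^(m+1+k), and a annihilates its power of q. *)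
rewrite addnS qfactS mulrA mulrBr mulr1 IHk -addSn exprD mulrA.
by rewrite [_ * _ * q ^+ m.+1]mulrAC aq0 !mul0r subr0.
Qed.

Lemma big_odd_even (R : comNzRingType) (F : nat -> R) n :
  \prod_(i < n.*2) F i = (\prod_(i < n) F i.*2) * \prod_(i < n) F i.*2.+1.
Proof.
elim: n => [|n IHn]; first by rewrite !big_ord0 mulr1.
by rewrite doubleS !big_ord_recr /= IHn; ring.
Qed.

Lemma expr0_leq (R : comNzRingType) (y : R) m n :
  (m <= n)%N -> y ^+ m = 0 -> y ^+ n = 0.
Proof. by move=> /subnKC <- y0; rewrite exprD y0 mul0r. Qed.

Lemma geometric_nilp (R : nzRingType) (y : R) n :
  y ^+ n = 0 -> (1 - y) * (\sum_(i < n) y ^+ i) = 1.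
Proof. by move=> y0; rewrite -opprB mulNr -subrX1 y0 sub0r opprK. Qed.

Lemma unit_1B_nilp (R : comUnitRingType) (y : R) n :
  y ^+ n = 0 -> 1 - y \is a GRing.unit.
Proof. by move/geometric_nilp=> yV; apply/unitrPr; eexists; exact: yV. Qed.

Section Nilpotent.
Variables (R : comUnitRingType) (n : nat).
Implicit Type y : R.

Lemma nilpX y k : y ^+ n.+1 = 0 -> (y ^+ k.+1) ^+ n.+1 = 0.
Proof. by move=> y0; rewrite exprAC y0 expr0n. Qed.

Lemma unit_1BX y k : y ^+ n.+1 = 0 -> 1 - y ^+ k.+1 \is a GRing.unit.
Proof. by move/(nilpX k); exact: unit_1B_nilp. Qed.

Lemma unit_qfact y m : y ^+ n.+1 = 0 -> qfact y m \is a GRing.unit.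
Proof. by move=> y0; apply: rpred_prod => i _; exact: unit_1BX. Qed.

Lemma qfact_stable y m :
  (n <= m)%N -> y ^+ n.+1 = 0 -> qfact y m = qfact y n.
Proof.
by move=> le_nm y0; have := @qfact_absorb R 1 y n m; rewrite !mul1r; apply.
Qed.

(* Gauss's series for phi(y) (e = 1) and phi(-y) (e = -1): multiplying by
   qfact (y^2) n turns every q-binomial coefficient into 1, up to y^n. *)
Lemma gauss (e y : R) : e * e = 1 -> y ^+ n.+1 = 0 ->
  qfact (y ^+ 2) n * (\prod_(i < n) (1 + e * y ^+ i.*2.+1)) ^+ 2 =
  \sum_(j < n.*2.+1) e ^+ (n + j) * y ^+ (`|j - n| ^ 2).
Proof.
move=> ee y0; have y20 : (y ^+ 2) ^+ n.+1 = 0 by apply: nilpX.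
rewrite -prodrXl finite_gauss // big_distrr /=; apply: eq_bigr => j _.
rewrite mulrC -!mulrA; congr (_ * _).
have le_j : (j <= n.*2)%N by rewrite -ltnS.
have := qbin_qfact (y ^+ 2) le_j.
(* By the symmetry between j and 2n - j, only the distance d = |j - n| matters. *)
have -> B : B * qfact (y ^+ 2) j * qfact (y ^+ 2) (n.*2 - j) =
    B * qfact (y ^+ 2) (n + `|j - n|) * qfact (y ^+ 2) (n - `|j - n|).
  case: (leqP n j) => [le_nj | /ltnW le_jn].
    by congr (_ * qfact _ _ * qfact _ _); lia.
  by rewrite mulrAC; congr (_ * qfact _ _ * qfact _ _); lia.
have : (`|j - n| <= n)%N by lia.
move: `|j - n|%N (qbin _ _ _) => d B le_dn.
rewrite !(@qfact_stable _ (n + d)) ?leq_addr // (@qfact_stable _ n.*2) //;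
  last by rewrite -addnn leq_addr.
(* The factors of [qfact (y ^+ 2) n] beyond index n - d are absorbed by y^(d^2), because d^2 +
   2(n-d+1) = (d-1)^2 + 2n + 1 exceeds n. *)
have := @qfact_absorb _ (y ^+ (d ^ 2)) (y ^+ 2) (n - d) n (leq_subr _ _).
have -> : y ^+ (d ^ 2) * y ^+ 2 ^+ (n - d).+1 = 0.
  by rewrite -exprM -exprD (expr0_leq _ y0) //; nia.
move=> /(_ erefl); have := unit_qfact n y20.
move: (qfact _ _) (qfact _ _) => F E uE EF BEF.
apply: (mulrI uE); transitivity (B * E * (y ^+ (d ^ 2) * E)); first by ring.
by rewrite EF -{2}BEF; ring.
Qed.

Lemma prod_odd_minus y : y ^+ n.+1 = 0 ->
  (\prod_(i < n) (1 + -1 * y ^+ i.*2.+1)) * qfact (y ^+ 2) n = qfact y n.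
Proof.
move=> y0; rewrite -(@qfact_stable y n.*2) //; last by rewrite -addnn leq_addr.
rewrite /qfact (big_odd_even (fun i => 1 - y ^+ i.+1)); congr (_ * _).
  by apply: eq_bigr => i _; rewrite mulN1r.
by apply: eq_bigr => i _; rewrite -exprM mul2n.
Qed.

Lemma qfact_plus y m :
  (\prod_(i < m) (1 + y ^+ i.+1)) * qfact y m = qfact (y ^+ 2) m.
Proof.
by rewrite -big_split; apply: eq_bigr => i _; rewrite /= exprAC; ring.
Qed.

(** The product of all 1 + y^i is f_2/f_1, and its even-indexed part is f_4/f_2; the odd-indexed
    part is therefore f_2^2/(f_1 f_4). *)
Lemma prod_odd_plus y : y ^+ n.+1 = 0 ->
  (\prod_(i < n) (1 + 1 * y ^+ i.*2.+1)) * (qfact (y ^+ 4) n * qfact y n) =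
  qfact (y ^+ 2) n ^+ 2.
Proof.
move=> y0; have y20 : (y ^+ 2) ^+ n.+1 = 0 by apply: nilpX.
have le_n2 : (n <= n.*2)%N by rewrite -addnn leq_addr.
have := qfact_plus y n.*2; rewrite !(qfact_stable le_n2) // => f12.
rewrite (exprM y 2 2) -(qfact_plus (y ^+ 2)) [RHS]expr2 -[X in _ = X * _]f12.
rewrite (big_odd_even (fun i => 1 + y ^+ i.+1)).
rewrite [X in X * (_ * _)](eq_bigr (fun i : 'I_n => 1 + y ^+ i.*2.+1)) => [|i _];
  last by rewrite mul1r.
rewrite [X in _ * (X * _ * _)](eq_bigr (fun i : 'I_n => 1 + y ^+ i.*2.+2)) => [|i _];
  last by rewrite -exprM mul2n.
by ring.
Qed.

(* f_1^a f_2^b f_4^c in the variable y, where f_m = qfact (y^m) n because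
   y^(n+1) = 0. *)
Definition fprod y (a b c : int) : R :=
  qfact y n ^ a * qfact (y ^+ 2) n ^ b * qfact (y ^+ 4) n ^ c.

Lemma fprodX y (a b c : int) (m : nat) :
  fprod y (a * m%:Z) (b * m%:Z) (c * m%:Z) = fprod y a b c ^+ m.
Proof. by rewrite /fprod -!exprz_exp !exprMn. Qed.

Lemma fprodD y (a b c a' b' c' : int) : y ^+ n.+1 = 0 ->
  fprod y (a + a') (b + b') (c + c') = fprod y a b c * fprod y a' b' c'.
Proof.
by move=> y0; rewrite /fprod !exprzDr ?unit_qfact ?nilpX //; ring.
Qed.

Lemma fprod_sqr y a b : fprod (y ^+ 2) a b 0 = fprod y 0 a b.
Proof. by rewrite /fprod -exprM !expr0z mul1r mulr1. Qed.

Lemma unit_fprod y a b c : y ^+ n.+1 = 0 -> fprod y a b c \is a GRing.unit.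
Proof. by move=> y0; rewrite !rpredM ?unitrXz ?unit_qfact ?nilpX. Qed.

End Nilpotent.

(** * Truncated power series and the embedding of integer series *)

Section Truncation.
Variable F : fieldType.

Notation trunc n := {poly %/ ('X^(n.+1) : {poly F})}.
Notation to_trunc n := (in_qpoly ('X^(n.+1) : {poly F})).

Definition tX n : trunc n := to_trunc n 'X.

Definition tcoef n (u : trunc n) i : F := (u : {poly F})`_i.

Section FixedOrder.
Variable n : nat.
Implicit Types u v : trunc n.

Lemma tcoef_trunc p i : (i <= n)%N -> tcoef (to_trunc n p) i = p`_i.
Proof.
move=> le_in; rewrite /tcoef /= mk_monic_Xn -Pdiv.RingMonic.take_poly_rmodp.
by rewrite coef_take_poly ltnS le_in.
Qed.

Lemma tcoef_oversize u i : (n < i)%N -> tcoef u i = 0.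
Proof.
move=> lt_ni; apply: nth_default; apply: leq_trans lt_ni.
by rewrite -ltnS (leq_trans (size_mk_monic u)) ?mk_monic_Xn ?size_polyXn.
Qed.

Lemma tcoefP u v : (forall i, (i <= n)%N -> tcoef u i = tcoef v i) <-> u = v.
Proof.
split=> [eq_uv | -> //]; apply/val_inj/polyP => i.
by case: (leqP i n) => [/eq_uv | lt_ni]; rewrite // [LHS]tcoef_oversize
  1?[RHS]tcoef_oversize.
Qed.

Lemma to_truncK u : to_trunc n (u : {poly F}) = u.
Proof. by apply/tcoefP => i le_in; rewrite tcoef_trunc. Qed.

Lemma tcoefM u v i : (i <= n)%N ->
  tcoef (u * v) i = \sum_(j < i.+1) tcoef u j * tcoef v (i - j).
Proof.
move=> le_in; rewrite -(to_truncK u) -(to_truncK v) -rmorphM.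
by rewrite tcoef_trunc // coefM !to_truncK.
Qed.

Lemma tcoef_sum I (r : seq I) (P : pred I) (G : I -> trunc n) i :
  tcoef (\sum_(k <- r | P k) G k) i = \sum_(k <- r | P k) tcoef (G k) i.
Proof. by rewrite /tcoef poly_of_qpoly_sum coef_sum. Qed.

Lemma tcoefZ c u i : tcoef (c *: u) i = c * tcoef u i.
Proof. by rewrite /tcoef poly_of_qpolyZ coefZ. Qed.

Lemma tcoefX m i : (i <= n)%N -> tcoef (tX n ^+ m) i = (i == m)%:R.
Proof. by move=> le_in; rewrite -rmorphXn tcoef_trunc // coefXn. Qed.

Lemma tX_nilp : tX n ^+ n.+1 = 0.
Proof.
apply/tcoefP => i le_in; rewrite tcoefX // /tcoef coef0.
by case: eqP le_in => // ->; rewrite ltnn.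
Qed.

Definition embed (a : fps) : trunc n :=
  to_trunc n (\poly_(i < n.+1) (a i)%:~R).

Lemma tcoef_embed a i : (i <= n)%N -> tcoef (embed a) i = (a i)%:~R.
Proof. by move=> le_in; rewrite tcoef_trunc // coef_poly ltnS le_in. Qed.

Lemma eq_embed a b : a =1 b -> embed a = embed b.
Proof. by move=> eq_ab; apply/tcoefP => i le_in; rewrite !tcoef_embed // eq_ab. Qed.

Lemma embed1 : embed fps_one = 1.
Proof.
apply/tcoefP => i le_in; rewrite tcoef_embed // -(expr0 (tX n)) tcoefX //.
by rewrite /fps_one; case: eqP.
Qed.

Lemma embedM a b : embed (fps_mul a b) = embed a * embed b.
Proof.
apply/tcoefP => i le_in; rewrite tcoef_embed // tcoefM // rmorph_sum.
apply: eq_bigr => j _; have le_jn : (j <= n)%N.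
  by apply: leq_trans le_in; rewrite -ltnS.
by rewrite rmorphM !tcoef_embed // (leq_trans (leq_subr _ _)).
Qed.

Lemma embed_exp a m : embed (fps_exp a m) = embed a ^+ m.
Proof. by elim: m => [|m IHm]; rewrite ?embed1 //= embedM IHm [RHS]exprS. Qed.

Lemma embedV a : a 0%N = 1 -> embed (fps_inv a) = (embed a)^-1.
Proof.
move=> /fps_mulrV/eq_embed; rewrite embedM embed1 => aV.
have ua : embed a \is a GRing.unit by apply/unitrPr; exists (embed (fps_inv a)).
by apply: (mulrI ua); rewrite aV divrr.
Qed.

Lemma embed_expz a z : a 0%N = 1 -> embed (fps_expz a z) = embed a ^ z.
Proof.
by move=> a0; case: z => m /=; rewrite ?embedM ?embed_exp ?embedV -?[LHS]exprS ?exprVn.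
Qed.

End FixedOrder.

Lemma qfact_trunc n m k :
  qfact (tX n ^+ m) k = to_trunc n (\prod_(i < k) (1 - 'X^(m * i.+1))).
Proof.
rewrite rmorph_prod; apply: eq_bigr => i _.
by rewrite rmorphB rmorph1 exprM !rmorphXn.
Qed.

Lemma embed_euler n m :
  (0 < m)%N -> embed n (euler_f m) = qfact (tX n ^+ m) n.
Proof.
move=> m_gt0; apply/tcoefP => i le_in; rewrite tcoef_embed // qfact_trunc.
(* The coefficient of q^i is read in the ring truncated at order i, where the factors of index above
   i become 1. This reconciles the n factors of [qfact] with the i factors used by [euler_f]. *)
rewrite tcoef_trunc // -(tcoef_trunc _ (leqnn i)) -qfact_trunc.
have tXm0 : (tX i ^+ m) ^+ i.+1 = 0.
  by rewrite -(prednK m_gt0) nilpX // tX_nilp.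
rewrite (qfact_stable le_in) // qfact_trunc tcoef_trunc //.
rewrite /euler_f -(big_mkord xpredT (fun j => 1 - 'X^(m * j.+1))) -coef_map.
rewrite rmorph_prod big_add1 /=; congr (polyseq _)`_i.
apply: eq_bigr => j _.
by rewrite rmorphB rmorph1 /= map_polyXn.
Qed.

Lemma euler_f0 m : euler_f m 0 = 1.
Proof. by rewrite /euler_f big_geq // coef1. Qed.

Lemma embed_bbar_gf n k r s :
  embed n (bbar_gf k r s) = fprod n (tX n) (- (2 * s%:Z * k%:Z))
    ((3 * s%:Z - 2 * r%:Z) * k%:Z) (- ((s%:Z - r%:Z) * k%:Z)).
Proof.
rewrite /bbar_gf !embedM !embed_expz ?euler_f0 // !embed_euler // expr1.
by rewrite mulrCA mulrA.
Qed.

End Truncation.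

(** * Generating function of overcolored partitions *)

Section SingleGF.
Variables (R : comUnitRingType) (n : nat).
Implicit Type x : R.
Local Notation mono := (fprod n).

(** This is 1 + 2z + 2z^2 + ..., the contribution of one colored part: each positive multiplicity
    counts twice, overlined or not. *)
Definition marked_factor (z : R) := (1 + z) / (1 - z).

Lemma marked_factorE (z : R) : z ^+ n.+1 = 0 ->
  \sum_(p : 'I_n.+1 * bool | p.2 ==> (0 < p.1)%N) z ^+ p.1 = marked_factor z.
Proof.
move=> z0; have uz := unit_1B_nilp z0; apply: (mulIr uz); rewrite divrK //.
rewrite -(pair_big_dep xpredT (fun (m : 'I_n.+1) b => b ==> (0 < m)%N)
  (fun (m : 'I_n.+1) _ => z ^+ m)) /=.
transitivity ((2 * (\sum_(m < n.+1) z ^+ m) - 1) * (1 - z)); last first.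
  transitivity (2 * ((1 - z) * \sum_(m < n.+1) z ^+ m) - (1 - z)); first by ring.
  by rewrite geometric_nilp //; ring.
congr (_ * _); rewrite !big_ord_recl /= expr0.
rewrite [X in X + _](_ : _ = 1); last first.
  by rewrite (big_pred1 false) //; case.
rewrite [X in 1 + X = _](_ : _ = (\sum_(i < n) z ^+ bump 0 i) *+ 2); first by ring.
rewrite -sumrMnl; apply: eq_bigr => i _.
by rewrite (eq_bigl xpredT) ?sumr_const ?card_bool //; case.
Qed.

Lemma prod_marked_factor (y : R) : y ^+ n.+1 = 0 ->
  (\prod_(i < n) marked_factor (y ^+ i.+1)) * qfact y n ^+ 2 = qfact (y ^+ 2) n.
Proof.
move=> y0; rewrite expr2 mulrA -(qfact_plus y); congr (_ * _).
rewrite -big_split; apply: eq_bigr => i _.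
by rewrite /= divrK // (unit_1BX _ y0).
Qed.

Definition single_gf r s x : R :=
  \sum_(la : marked_partition r s n | overcolored la) x ^+ weight la.

(** Expanding a product of one sum per colored part picks a multiplicity and a flag for each, that
    is, an overcolored partition. Bounding multiplicities by n is harmless since x^(n+1) = 0. *)
Lemma single_gf_prod r s x : x ^+ n.+1 = 0 -> single_gf r s x =
  \prod_(i < n) marked_factor (x ^+ i.+1) ^+ ncolors r s i.+1.
Proof.
move=> x0.
transitivity (\prod_(p : colored_part r s n) marked_factor (x ^+ (tag p).+1)).
  rewrite [RHS](eq_bigr _ (fun p _ => esym (marked_factorE (nilpX (tag p : 'I_n) x0)))).
  rewrite bigA_distr_big /=; apply: eq_big => [la | la _].
    by apply/forallP/ffun_onP.
  by rewrite expr_sum; apply: eq_bigr => p _; rewrite exprM.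
rewrite -(sig_big_dep xpredT (fun=> xpredT)
  (fun (i : 'I_n) (_ : 'I_(ncolors r s i.+1)) => marked_factor (x ^+ i.+1))) /=.
by apply: eq_bigr => i _; rewrite prodr_const card_ord.
Qed.

(** Even sizes give E = f_4/f_2^2 and all sizes give O E = f_2/f_1^2, so odd sizes give O =
    f_2^3/(f_1^2 f_4). The series is O^s E^r. *)
Lemma single_gfE r s x : x ^+ n.+1 = 0 ->
  single_gf r s x = mono x (- (2 * s%:Z)) (3 * s%:Z - 2 * r%:Z) (r%:Z - s%:Z).
Proof.
move=> x0; pose G i := marked_factor (x ^+ i.+1).
have G1 i : (n <= i)%N -> G i = 1.
  move=> le_ni; rewrite /G /marked_factor.
  by rewrite (@expr0_leq _ _ n.+1) ?x0 // addr0 subr0 divr1.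
(* Doubling the range by trivial factors leaves n factors in each parity class. Since [G i] belongs
   to size i + 1, even indices carry the odd sizes. *)
have ext (H : nat -> R) : (forall i, (n <= i)%N -> H i = 1) ->
    \prod_(i < n) H i = \prod_(i < n.*2) H i.
  move=> H1; rewrite -addnn big_split_ord /= [X in _ * X]big1 ?mulr1 // => i _.
  by rewrite H1 // leq_addr.
pose E := \prod_(i < n) G i.*2.+1; pose O := \prod_(i < n) G i.*2.
have Ef : E * qfact (x ^+ 2) n ^+ 2 = qfact (x ^+ 4) n.
  rewrite (exprM x 2 2) -[RHS]prod_marked_factor ?nilpX //; congr (_ * _).
  by apply: eq_bigr => i _; rewrite /G -exprM mul2n doubleS.
have OEf : O * E * qfact x n ^+ 2 = qfact (x ^+ 2) n.
  by rewrite -[RHS]prod_marked_factor ?x0 // -(big_odd_even G) -ext.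
have EE : E = mono x 0 (- 2) 1.
  rewrite /mono -Ef expr0z mul1r expr1z mulrC -mulrA -exprnN divrr ?mulr1 //.
  by apply: unitrX; apply: (@unit_qfact _ n); apply: nilpX.
have OE : O * E = mono x (- 2) 1 0.
  rewrite /mono -OEf expr0z mulr1 expr1z [RHS]mulrC -[RHS]mulrA -exprnN divrr ?mulr1 //.
  by apply: unitrX; apply: (@unit_qfact _ n).
have OO : O = mono x (- 2) 3 (- 1).
  have uE : E \is a GRing.unit by rewrite EE unit_fprod.
  by apply: (mulIr uE); rewrite OE EE -fprodD.
have -> : single_gf r s x = \prod_(i < n.*2) G i ^+ ncolors r s i.+1.
  rewrite single_gf_prod // -(ext (fun i => G i ^+ ncolors r s i.+1)) // => i le_ni.
  by rewrite G1 ?expr1n.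
rewrite (big_odd_even (fun i => G i ^+ ncolors r s i.+1)).
rewrite (eq_bigr (fun i : 'I_n => G i.*2 ^+ s)) => [|i _]; last first.
  by rewrite /ncolors /= odd_double.
rewrite [X in _ * X](eq_bigr (fun i : 'I_n => G i.*2.+1 ^+ r)) => [|i _]; last first.
  by rewrite /ncolors /= odd_double.
rewrite !prodrXl -/O -/E OO EE -!fprodX -fprodD //.
by congr mono; lia.
Qed.

End SingleGF.

(** * Counting tuples by coefficients *)

Section Count.
Variables (F : fieldType) (n : nat).
Local Notation x := (tX F n).

Lemma tuples_gf k r s :
  tcoef (single_gf n r s x ^+ k) n = #|overcolored_tuples k r s n|%:R.
Proof.
rewrite -[X in _ ^+ X]card_ord -prodr_const bigA_distr_big tcoef_sum.
rewrite -sum1_card natr_sum [RHS](eq_bigl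
  (fun L : {ffun 'I_k -> marked_partition r s n} =>
    (L \in ffun_on (@overcolored r s n)) &&
    ((\sum_j weight (L j))%N == n))) => [|L]; last first.
  by rewrite inE; congr (_ && _); apply/forallP/ffun_onP.
rewrite [RHS]big_mkcondr /=; apply: eq_bigr => L _.
by rewrite -expr_sum tcoefX // eq_sym; case: eqP.
Qed.

(** Both branches of [bbar] lead to the same product: the count through [tuples_gf], the formal
    series through [embed_bbar_gf]. *)
Lemma tcoef_bbar k r s :
  tcoef (fprod n x (- (2 * s%:Z * k%:Z)) ((3 * s%:Z - 2 * r%:Z) * k%:Z)
    (- ((s%:Z - r%:Z) * k%:Z))) n = (bbar k r s n)%:~R.
Proof.
rewrite /bbar; case: ifP => _; last by rewrite -embed_bbar_gf tcoef_embed.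
rewrite -[RHS]tuples_gf single_gfE ?tX_nilp // -fprodX.
by congr (tcoef (fprod _ _ _ _ _) n); lia.
Qed.

End Count.

(** * Theta series as products of f_1, f_2, f_4 *)

Section Theta.
Variables (R : comUnitRingType) (n : nat) (y : R).
Hypothesis y0 : y ^+ n.+1 = 0.

Lemma phi_minus :
  fprod n y 2 (- 1) 0 = \sum_(j < n.*2.+1) (-1) ^+ (n + j) * y ^+ (`|j - n| ^ 2).
Proof.
rewrite -gauss ?mulrNN ?mulr1 // /fprod -(prod_odd_minus y0) expr0z mulr1.
have uf2 : qfact (y ^+ 2) n \is a GRing.unit by apply/unit_qfact/nilpX/y0.
set f2 := qfact _ _ in uf2 *; set p := \prod_(i < n) _.
by rewrite -[_ ^ 2]/(_ ^+ 2) exprMn -mulrA [f2 ^+ 2]expr2 mulrK // mulrC.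
Qed.

(** By [gauss] with e = 1 and [prod_odd_plus], the series is f_2 (f_2^2/(f_1 f_4))^2. *)
Lemma phi_plus :
  fprod n y (- 2) 5 (- 2) = \sum_(j < n.*2.+1) y ^+ (`|j - n| ^ 2).
Proof.
have uf m : qfact (y ^+ m.+1) n \is a GRing.unit by apply/unit_qfact/nilpX/y0.
have uf1 : qfact y n \is a GRing.unit by apply/unit_qfact/y0.
transitivity (\sum_(j < n.*2.+1) 1 ^+ (n + j) * y ^+ (`|j - n| ^ 2)); last first.
  by apply: eq_bigr => j _; rewrite expr1n mul1r.
rewrite -gauss ?mulr1 // /fprod.
have := prod_odd_plus y0; move: (uf 1%N) (uf 3%N) uf1.
move: (qfact _ _) (qfact _ _) (qfact _ _) (\prod_(i < n) _) => f1 f4 f2 p.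
move=> u2 u4 u1 pE.
have u14 : (f4 * f1) ^+ 2 \is a GRing.unit by rewrite unitrX // unitrM u1 u4.
apply: (mulIr u14); rewrite -[RHS]mulrA -exprMn pE.
transitivity (f2 ^ 5 * (f1 ^ (- 2) * f1 ^+ 2) * (f4 ^ (- 2) * f4 ^+ 2)).
  by rewrite exprMn; ring.
by rewrite -!exprnN !mulVr ?unitrX // !mulr1 -exprM -exprS.
Qed.

End Theta.

(** * Supports of series modulo 9, over the field with three elements *)

Section Support.
Variable n : nat.
Notation trunc := {poly %/ ('X^(n.+1) : {poly 'F_3})}.
Local Notation x := (tX 'F_3 n).
Local Notation mono := (fprod n x).
Implicit Types (u v : trunc) (S T V : seq nat).

Definition supp9 S u := forall i, tcoef u i != 0 -> (i %% 9)%N \in S.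

Lemma supp9_sub S T u : {subset S <= T} -> supp9 S u -> supp9 T u.
Proof. by move=> sST Su i /Su/sST. Qed.

Lemma supp9_sum S I (r : seq I) (G : I -> trunc) :
  (forall i, supp9 S (G i)) -> supp9 S (\sum_(i <- r) G i).
Proof.
move=> SG i; rewrite tcoef_sum => nz.
have [j jr] : exists j, tcoef (G j) i != 0; last exact: SG jr.
elim: r nz => [|j r IHr]; first by rewrite big_nil eqxx.
rewrite big_cons; case: (eqVneq (tcoef (G j) i) 0) => [->|]; last by exists j.
by rewrite add0r => /IHr.
Qed.

(** The condition on the residue lists is boolean, so each use discharges it by computation. *)
Lemma supp9M S T V u v :
  all (fun i => all (fun j => (i + j) %% 9 \in V)%N T) S ->
  supp9 S u -> supp9 T v -> supp9 V (u * v).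
Proof.
move=> /allP STV Su Tv i nz.
have le_in : (i <= n)%N.
  by case: leqP nz => // lt_ni; rewrite tcoef_oversize ?eqxx.
move: nz; rewrite tcoefM // => nz.
have [j] : exists j : 'I_i.+1, tcoef u j * tcoef v (i - j) != 0.
  apply/existsP; apply: contraNT nz => /existsPn nz.
  by rewrite big1 // => j _; have /negPn/eqP := nz j.
rewrite mulf_eq0 negb_or => /andP[/Su /STV/allP STj /Tv/STj].
by rewrite modnDm subnKC // -ltnS.
Qed.

Lemma supp9_scale S c u : supp9 S u -> supp9 S (c *: u).
Proof. by move=> Su i; rewrite tcoefZ mulf_eq0 negb_or => /andP[_ /Su]. Qed.

Lemma supp9_X m : supp9 [:: m %% 9]%N (x ^+ m).
Proof.
move=> i nz; have le_in : (i <= n)%N.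
  by case: leqP nz => // lt_ni; rewrite tcoef_oversize ?eqxx.
by move: nz; rewrite tcoefX // inE; have [->|] := eqVneq i m; rewrite ?eqxx.
Qed.

Lemma pchar_trunc : 3%N \in [pchar trunc].
Proof. by rewrite pchar_qpoly pchar_Fp. Qed.

(** Cubing is the Frobenius morphism, so the cube of the sum of c_i X^i is the sum of c_i^3
    X^(3i). *)
Lemma supp9_cube S u :
  supp9 S u -> supp9 [seq (3 * i) %% 9 | i <- S]%N (u ^+ 3).
Proof.
move=> Su; have {1}-> : u = \sum_(i < n.+1) tcoef u i *: x ^+ i.
  apply/tcoefP => i le_in; rewrite tcoef_sum (bigD1 (inord i)) //=.
  rewrite tcoefZ tcoefX // inordK //.
  rewrite eqxx mulr1 big1 ?addr0 // => j; rewrite -val_eqE /= inordK // => ne_ji.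
  rewrite tcoefZ tcoefX // eq_sym (negPf ne_ji).
  by rewrite mulr0.
rewrite -(pFrobenius_autE pchar_trunc) rmorph_sum /=.
apply: supp9_sum => i; rewrite pFrobenius_autE exprZn -exprM.
case: (eqVneq (tcoef u i) 0) => [-> | /Su Si].
  by rewrite expr0n scale0r => j; rewrite /tcoef coef0 eqxx.
apply/supp9_scale/(supp9_sub _ (@supp9_X _)) => j; rewrite inE => /eqP->.
by apply/mapP; exists (i %% 9)%N => //; rewrite modnMmr mulnC.
Qed.

(** Two cubings, starting from all residues, multiply exponents by 9. *)
Lemma supp9_ninth u : supp9 [:: 0%N] (u ^+ 9).
Proof.
have /supp9_cube/supp9_cube : supp9 (iota 0 9) u.
  by move=> i _; rewrite mem_iota ltn_mod.
by rewrite -exprM; apply: supp9_sub; apply/allP.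
Qed.

Lemma supp9_square_power k d :
  supp9 [seq (k * i) %% 9 | i <- [:: 0; 1; 4; 7]]%N ((x ^+ k) ^+ (d ^ 2)).
Proof.
rewrite -exprM; apply: supp9_sub (@supp9_X _) => j; rewrite inE => /eqP->.
rewrite -modnMmr; apply/mapP; exists (d ^ 2 %% 9)%N => //.
rewrite -modnXm; have : (d %% 9 < 9)%N by rewrite ltn_mod.
(* The nine residues of d are checked one by one. *)
by move: (d %% 9)%N; do 9?[case=> //].
Qed.

Lemma supp9_sign S k u : supp9 S u -> supp9 S ((-1) ^+ k * u).
Proof.
move=> Su; rewrite -signr_odd; case: odd; rewrite ?expr0 ?mul1r // expr1 mulN1r.
by rewrite -scaleN1r; apply: supp9_scale.
Qed.

Lemma supp9_phi_minus k : (0 < k)%N ->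
  supp9 [seq (k * i) %% 9 | i <- [:: 0; 1; 4; 7]]%N (fprod n (x ^+ k) 2 (- 1) 0).
Proof.
case: k => // k _; rewrite phi_minus ?nilpX ?tX_nilp //.
by apply: supp9_sum => j; apply/supp9_sign/supp9_square_power.
Qed.

Lemma supp9_phi_plus : supp9 [:: 0; 1; 4; 7]%N (mono (- 2) 5 (- 2)).
Proof.
rewrite phi_plus ?tX_nilp //; apply: supp9_sum => j.
by have := @supp9_square_power 1 `|j - n|%N; rewrite expr1.
Qed.

Lemma supp9_phi_minus1 : supp9 [:: 0; 1; 4; 7]%N (mono 2 (- 1) 0).
Proof. exact: (@supp9_phi_minus 1). Qed.

Lemma supp9_phi_minus2 : supp9 [:: 0; 2; 8; 5]%N (mono 0 2 (- 1)).
Proof.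
by have := @supp9_phi_minus 2 isT; rewrite fprod_sqr.
Qed.

Lemma supp9_phi_minus2_cube : supp9 [:: 0; 6]%N (mono 0 6 (- 3)).
Proof.
rewrite (fprodX n x 0 2 (- 1) 3).
by apply: supp9_sub (supp9_cube supp9_phi_minus2); apply/allP.
Qed.

(* The exponents of f_1, f_2, f_4 in the factor Q(q) attached to the sets A, B,
   C, D and E, in this order. *)
Definition theta_exponents : seq (int * int * int) :=
  [:: (- 2, 5, - 2); (2, - 1, 0); (0, 2, - 1); (- 4, 10, - 4); (4, - 2, 0)].

(** A sum of two squares is never 3 or 6 modulo 9. Both residues must be excluded, since the factor
    phi(-q^2)^3 shifts exponents by 0 or 6. *)
Lemma supp9_theta a b c : (a, b, c) \in theta_exponents ->
  supp9 [:: 0; 1; 2; 4; 5; 7; 8]%N (mono a b c).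
Proof.
rewrite !inE => /orP[|/orP[|/orP[|/orP[|]]]] /eqP[-> -> ->].
- by apply: supp9_sub supp9_phi_plus; apply/allP.
- by apply: supp9_sub supp9_phi_minus1; apply/allP.
- by apply: supp9_sub supp9_phi_minus2; apply/allP.
- rewrite (fprodX n x (- 2) 5 (- 2) 2) expr2.
  by apply: (supp9M _ supp9_phi_plus supp9_phi_plus).
- rewrite (fprodX n x 2 (- 1) 0 2) expr2.
  by apply: (supp9M _ supp9_phi_minus1 supp9_phi_minus1).
Qed.

(* (0, 6, -3) are the exponents of phi(-q^2)^3. *)
Lemma supp9_fprod a b c a' b' c' : (a, b, c) \in theta_exponents ->
  (a' = a %[mod 9])%Z -> (b' = b + 6 %[mod 9])%Z -> (c' = c - 3 %[mod 9])%Z ->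
  supp9 [:: 0; 1; 2; 4; 5; 6; 7; 8]%N (mono a' b' c').
Proof.
move=> abc ea eb ec.
have mod9 z z' : (z' = z %[mod 9])%Z -> z' = z + ((z' %/ 9)%Z - (z %/ 9)%Z) * 9%N%:Z.
  by move=> ez; rewrite {1}(divz_eq z' 9) {1}(divz_eq z 9) ez; ring.
(* The multiples of 9 in the exponents form a ninth power, supported on residue 0; the rest splits
   as (a, b, c) + (0, 6, -3). *)
rewrite (mod9 _ _ ea) (mod9 _ _ eb) (mod9 _ _ ec) fprodD ?tX_nilp // fprodX.
rewrite -[X in mono X _ _]addr0 [mono (a + 0) _ _]fprodD ?tX_nilp //.
have Sq := supp9M _ (supp9_theta abc) supp9_phi_minus2_cube.
by apply: (supp9M _ (Sq [:: 0; 1; 2; 4; 5; 6; 7; 8]%N isT) (@supp9_ninth _)).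
Qed.

End Support.

(** * Verification of the triples and conclusion *)

Definition theta_class (p : nat * nat * nat) (q : int * int * int) :=
  let: (t, u, l) := p in let: (a, b, c) := q in
  [&& (- (2 * u%:Z * l%:Z) == a %[mod 9])%Z,
      ((3 * u%:Z - 2 * t%:Z) * l%:Z == b + 6 %[mod 9])%Z &
      (- ((u%:Z - t%:Z) * l%:Z) == c - 3 %[mod 9])%Z].

Lemma triples_theta_class :
  all (fun p => has (theta_class p) theta_exponents)
    (triplesA ++ triplesB ++ triplesC ++ triplesD ++ triplesE).
Proof. by vm_compute. Qed.

Lemma bbar_mod3 n r s k t u l q : q \in theta_exponents ->
  theta_class (t, u, l) q ->
  (bbar (9 * k + l) (9 * r + t) (9 * s + u) (9 * n + 3) = 0 %[mod 3])%Z.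
Proof.
case: q => [[a b] c] abc /and3P[/eqP ea /eqP eb /eqP ec].
set N := (9 * n + 3)%N; set B := bbar _ _ _ _.
suff : (B%:~R : 'F_3) = 0.
  move/eqP; rewrite -(dvdz_pcharf (pchar_Fp (isT : prime 3))).
  by move/dvdz_mod0P => ->; rewrite mod0z.
rewrite -tcoef_bbar; apply/eqP; set w := fprod _ _ _ _ _.
(* The list omits 3, the residue of N, so the coefficient at N must vanish. *)
suff /(_ N) : supp9 [:: 0; 1; 2; 4; 5; 6; 7; 8]%N w.
  by case: eqP => // _ /(_ isT); rewrite /N mulnC modnMDl.
(* Here d is the quotient by 9 of the change in an exponent when t, u, l are replaced by 9r + t, 9s
   + u, 9k + l. *)
have mod9 (d z z' e : int) :
    (z = e %[mod 9])%Z -> z' = d * 9 + z -> (z' = e %[mod 9])%Z.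
  by move=> <- ->; rewrite modzMDl.
apply: (supp9_fprod abc).
- apply: mod9 (- 2 * (u%:Z * k%:Z + s%:Z * (9 * k%:Z + l%:Z))) _ _ _ ea _.
  by rewrite !(PoszD, PoszM); ring.
- apply: mod9 ((3 * u%:Z - 2 * t%:Z) * k%:Z +
    (3 * s%:Z - 2 * r%:Z) * (9 * k%:Z + l%:Z)) _ _ _ eb _.
  by rewrite !(PoszD, PoszM); ring.
- apply: mod9 (- ((u%:Z - t%:Z) * k%:Z +
    (s%:Z - r%:Z) * (9 * k%:Z + l%:Z))) _ _ _ ec _.
  by rewrite !(PoszD, PoszM); ring.
Qed.

Local Close Scope ring_scope.

Theorem theorem1p13 (n r s k t u l : nat)
    (htul : (t, u, l) \in
       triplesA ++ triplesB ++ triplesC ++ triplesD ++ triplesE) :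
  (bbar (9 * k + l) (9 * r + t) (9 * s + u) (9 * n + 3) = 0 %[mod 3])%Z.
Proof.
by have /allP/(_ _ htul)/hasP[q] := triples_theta_class; exact: bbar_mod3.
Qed.
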